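(* Let $D$ be a dense group-like subset of $\mathbb{Q}\cap[0,\infty)$. Then there exists a good infinite ergodic $\mathcal{R}$-invariant measure $\widehat{\mu}$ on a Bratteli diagram of finite rank such that $S(\widehat{\mu})=D$.
   Context: A dense countable unbounded subset $D\subset[0,\infty)$ is group-like if for every $\gamma\in D$ there is an additive subgroup $G$ of $\mathbb{R}$ such that $D\cap[0,\gamma]=G\cap[0,\gamma]$; here $D\subset\mathbb{Q}$ and $D$ is dense in $[0,\infty)$. A Bratteli diagram $B$ is a graded graph with finite vertex levels $V_0=\{v_0\},V_1,V_2,\ldots$ and finite edge sets $E_k$ ($k\ge1$), multiple edges allowed, edges of $E_k$ going from $V_{k-1}$ to $V_k$, such that every vertex has an outgoing edge and every vertex other than $v_0$ has an incoming edge. It has finite rank if the numbers $|V_k|$ are bounded. $X_B$ is the space of infinite paths starting at $v_0$, with topology generated by the (clopen) cylinder sets of paths with a prescribed initial segment. The tail equivalence relation $\mathcal{R}$ on $X_B$ relates two paths if they coincide from some level on. A measure on $X_B$ is $\mathcal{R}$-invariant if for any two finite paths $e,e'$ from $v_0$ to the same vertex, replacing the initial segment $e$ by $e'$ preserves the measure; it is ergodic if every $\mathcal{R}$-invariant Borel set is null or has null complement. Measures are considered on their supports. A Borel measure on a Cantor space $X$ is full if every non-empty open set has positive measure. An infinite full non-atomic Borel measure $\mu$ on $X$ is non-defective if $\mu(\mathfrak{M}_\mu)=0$, where $\mathfrak{M}_\mu=\{x\in X:\mu(U)=\infty\text{ for every clopen }U\ni x\}$. For such $\mu$, $S(\mu)=\{\mu(U):U\text{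 clopen},\ \mu(U)<\infty\}$. A non-defective $\mu$ is good if whenever $U,V$ are clopen with $\mu(U)<\mu(V)$, there is a clopen $W\subset V$ with $\mu(W)=\mu(U)$ (good measures are by definition non-defective). *)

(* Defs.v *)
From HB Require Import structures.
From mathcomp Require Import all_boot all_order all_algebra.
From mathcomp Require Import all_classical all_reals all_analysis.
Import Order.TTheory GRing.Theory Num.Theory.
Import numFieldNormedType.Exports.

Set Implicit Arguments.
Unset Strict Implicit.
Unset Printing Implicit Defensive.

Local Open Scope classical_set_scope.
Local Open Scope ring_scope.

Definition group_like (R : realType) (D : set R) : Prop :=
  [/\ D `<=` `[0, +oo[,
      `[0, +oo[ `<=` closure D,
      countable D,
      ~ has_ubound D
    & forall g : R, D g ->
        exists G : zmodClosed R, D `&` `[0, g] = [set` G] `&` `[0, g] ].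

(* [bd_edge k] is the set of edges from level [k] to level [k.+1], usually
   written E_{k+1}. *)
Record bratteli := Bratteli {
  bd_vertex : nat -> finType;
  bd_root : bd_vertex 0;
  bd_root_unique : forall v : bd_vertex 0, v = bd_root;
  bd_edge : nat -> finType;
  bd_src : forall k, bd_edge k -> bd_vertex k;
  bd_tgt : forall k, bd_edge k -> bd_vertex k.+1;
  bd_outgoing : forall k (v : bd_vertex k), exists e : bd_edge k, bd_src e = v;
  bd_incoming : forall k (v : bd_vertex k.+1), exists e : bd_edge k, bd_tgt e = v
}.

Definition finite_rank (B : bratteli) : Prop :=
  exists d : nat, forall k, (#|{: bd_vertex B k}| <= d)%N.

Inductive finpath (B : bratteli) : forall n, bd_vertex B n -> Type :=
  | finpath_nil : finpath (bd_root B)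
  | finpath_rcons n (e : bd_edge B n) : finpath (bd_src e) -> finpath (bd_tgt e).

(* Infinite paths automatically start at the root, the only vertex of level 0. *)
Record ipath (B : bratteli) := IPath {
  ip_edge :> forall k, bd_edge B k;
  ip_compat : forall k, bd_tgt (ip_edge k) = bd_src (ip_edge k.+1)
}.

Fixpoint cylinder (B : bratteli) n (v : bd_vertex B n) (p : finpath v) :
    set (ipath B) :=
  match p with
  | finpath_nil => setT
  | finpath_rcons m e q => cylinder q `&` [set x | x m = e]
  end.

Section ipath_structures.
Variable B : bratteli.

Fixpoint some_ipath_edge k : bd_edge B k :=
  match k with
  | 0 => projT1 (cid (bd_outgoing (bd_root B)))
  | j.+1 => projT1 (cid (bd_outgoing (bd_tgt (some_ipath_edge j))))
  end.

Lemma some_ipath_compat k :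
  bd_tgt (some_ipath_edge k) = bd_src (some_ipath_edge k.+1).
Proof. by rewrite /=; case: cid. Qed.

HB.instance Definition _ := gen_eqMixin (ipath B).
HB.instance Definition _ := gen_choiceMixin (ipath B).
HB.instance Definition _ := isPointed.Build (ipath B) (IPath some_ipath_compat).
HB.instance Definition _ := isSubBaseTopological.Build (ipath B)
  [set C | exists n (v : bd_vertex B n) (p : finpath v), C = cylinder p] id.

End ipath_structures.

Notation borel X := (g_sigma_algebraType (@open X)).

Definition tail_equiv (B : bratteli) (x y : ipath B) : Prop :=
  exists n, forall k, (n <= k)%N -> x k = y k.

Definition tail_invariant_set (B : bratteli) (A : set (ipath B)) : Prop :=
  forall x y, tail_equiv x y -> A x -> A y.

(* For [A `<=` cylinder p] and [q] a path with the same end vertex as [p], the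
   image of [A] under replacement of the initial segment [p] by [q]. *)
Definition replace_prefix (B : bratteli) n (v : bd_vertex B n) (q : finpath v)
    (A : set (ipath B)) : set (ipath B) :=
  cylinder q `&` [set y | exists2 x, A x & forall k, (n <= k)%N -> y k = x k].

Section measures_on_path_space.
Variables (R : realType) (B : bratteli).
Variable mu : {measure set (borel (ipath B)) -> \bar R}.

Definition tail_invariant_measure : Prop :=
  forall n (v : bd_vertex B n) (p q : finpath v) (A : set (ipath B)),
    measurable (A : set (borel (ipath B))) -> A `<=` cylinder p ->
    mu (replace_prefix q A) = mu A.

Definition ergodic : Prop :=
  forall A : set (ipath B), measurable (A : set (borel (ipath B))) ->
    tail_invariant_set A -> mu A = 0%E \/ mu (~` A) = 0%E.

Definition msupport : set (ipath B) :=
  [set x | forall U : set (ipath B), open U -> U x -> (0 < mu U)%E].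

(* The measure induced by [mu] on its support, a closed set that carries the
   subspace topology via [set_type]. *)
Definition on_support (A : set msupport) : \bar R := mu (set_val @` A).

End measures_on_path_space.
Arguments on_support {R B} mu A.

(* A Borel measure on [X] is given here by its underlying set function, since
   [measurableType] would require [X] to come with a distinguished point. *)
Section measures_on_cantor_sets.
Variables (R : realType) (X : topologicalType) (nu : set X -> \bar R).

Definition full_measure : Prop :=
  forall U : set X, open U -> U !=set0 -> (0 < nu U)%E.

Definition nonatomic : Prop :=
  forall A : set X, <<s open >> A -> (0 < nu A)%E ->
    exists C : set X, [/\ <<s open >> C, C `<=` A, (0 < nu C)%E & (nu C < nu A)%E].

Definition defective_set : set X :=
  [set x | forall U : set X, clopen U -> U x -> nu U = +oo%E].

Definition nondefective : Prop :=
  [/\ cantor_like X, full_measure, nonatomic, nu setT = +oo%E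
    & nu defective_set = 0%E].

Definition clopen_values : set R :=
  [set r | exists2 U : set X, clopen U & nu U = r%:E].

Definition good_infinite_measure : Prop :=
  nondefective /\
  forall U V : set X, clopen U -> clopen V -> (nu U < nu V)%E ->
    exists W : set X, [/\ clopen W, W `<=` V & nu W = nu U].

End measures_on_cantor_sets.

(* Main.v *)
(* A group-like set D is the set of nonnegative elements of a dense subgroup of
   Q, so there are a > 0 and natural numbers M 0 = 1, M 1, M 2, ..., each
   dividing the next, with D = { k a / M n }. The diagram consists of infinitely
   many disjoint odometers with digit bases M (n + 1) / M n, one branching off at
   each level from a single path x_inf of vertices None, so that the path space
   is the one-point compactification, by x_inf, of a countable union of Cantor
   sets. Reading the digits of a real number t >= 0 in these bases, with
   the integer part of t choosing the odometer, maps [0, +oo[ to the path space,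
   and mu is a times the image of the Lebesgue measure. The level-n cylinders
   other than that of x_inf, which has infinite measure, correspond to the
   intervals [j / M n, (j + 1) / M n[ with j < n M n. Invariance under tails is
   translation invariance; a clopen set of finite measure is a finite union of
   intervals of a common length a / M n, which gives goodness and S(mu) = D; and
   for a tail-invariant A, B |-> mu (A `&` B) is invariant, hence proportional
   to mu, so evaluating at the complement of A gives ergodicity. *)

Require Import Defs.
From HB Require Import structures.
From mathcomp Require Import all_boot all_order all_algebra.
From mathcomp Require Import all_classical all_reals all_analysis.
From mathcomp Require Import finmap ring lra zify.
Import Order.TTheory GRing.Theory Num.Theory.
Import numFieldNormedType.Exports.

Local Open Scope classical_set_scope.
Local Open Scope ring_scope.

Set Implicit Arguments.
Unset Strict Implicit.
Unset Printing Implicit Defensive.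

(** * Group-like sets of rationals *)

(** This is M of the overview. The digit base at place [m] is stored as [(q m).+1], so that it is
    positive for every [q]. *)
Fixpoint odo (q : nat -> nat) n : nat :=
  if n is m.+1 then (odo q m * (q m).+1)%N else 1%N.

Lemma odo_gt0 q n : (0 < odo q n)%N.
Proof. by elim: n => //= n IHn; rewrite muln_gt0 IHn. Qed.

Lemma odo_dvd q m n : (m <= n)%N -> exists k, odo q n = (odo q m * k)%N.
Proof.
move=> /subnK <-; elim: (n - m)%N => [|k [l IHk]]; first by exists 1%N; rewrite muln1.
by exists (l * (q (k + m)%N).+1)%N; rewrite addSn /= IHk mulnA.
Qed.

Lemma leq_odo q m n : (m <= n)%N -> (odo q m <= odo q n)%N.
Proof.
move=> /(odo_dvd q)[k E]; have := odo_gt0 q n.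
by rewrite E muln_gt0 => /andP[_ k0]; rewrite leq_pmulr.
Qed.

Section group_like_subsets.
Context {R : realType} {D : set R}.
Hypothesis D_group_like : group_like D.

Lemma group_like_ge0 x : D x -> 0 <= x.
Proof.
by case: D_group_like => D0 _ _ _ _ /D0; rewrite /= in_itv/= andbT.
Qed.

Lemma group_like_unbounded x : exists2 y, D y & x <= y.
Proof.
case: D_group_like => _ _ _ nubD _; apply: contrapT => nD; apply: nubD.
exists x => y Dy; rewrite leNgt; apply/negP => /ltW xy.
by apply: nD; exists y.
Qed.

(** As [D] is unbounded, some [g] in [D] exceeds [x + y]; the group attached to [g] then serves for
    computing with both elements at once. *)
Lemma group_like_trace x y : D x -> D y -> exists G : zmodClosed R,
  [/\ x \in G, y \in G & forall z, z \in G -> 0 <= z <= x + y -> D z].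
Proof.
move=> Dx Dy; have x0 := group_like_ge0 Dx; have y0 := group_like_ge0 Dy.
have [g Dg xyg] := group_like_unbounded (x + y).
case: D_group_like => _ _ _ _ /(_ g Dg)[G /seteqP[DG GD]]; exists G.
have inG z : D z -> z <= x + y -> z \in G.
  move=> Dz zxy; suff [] : ([set` G] `&` `[0, g]) z by [].
  apply: DG; split => //=; rewrite in_itv/= group_like_ge0//=; lra.
split; [by apply: inG => //; lra|by apply: inG => //; lra|].
move=> z Gz z0; suff [] : (D `&` `[0, g]) z by [].
by apply: GD; split => //=; rewrite in_itv/=; lra.
Qed.

Lemma group_likeD x y : D x -> D y -> D (x + y).
Proof.
move=> Dx Dy; have [G [Gx Gy GD]] := group_like_trace Dx Dy.
have := group_like_ge0 Dx; have := group_like_ge0 Dy => y0 x0.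
by apply: GD; [exact: rpredD|lra].
Qed.

Lemma group_likeB x y : D x -> D y -> x <= y -> D (y - x).
Proof.
move=> Dx Dy xy; have [G [Gx Gy GD]] := group_like_trace Dx Dy.
have := group_like_ge0 Dx; have := group_like_ge0 Dy => y0 x0.
by apply: GD; [exact: rpredB|lra].
Qed.

Lemma group_like0 : D 0.
Proof.
have [x Dx _] := group_like_unbounded 0.
by rewrite -(subrr x); exact: group_likeB.
Qed.

Lemma group_likeMn x n : D x -> D (x * n%:R).
Proof.
move=> Dx; elim: n => [|n IHn]; first by rewrite mulr0; exact: group_like0.
by rewrite -natr1 mulrDr mulr1; exact: group_likeD.
Qed.

(** By Bezout with natural coefficients, the gcd is a difference of a multiple of [m] and a multiple
    of [n]. *)
Lemma group_like_gcd u m n : D (u * m%:R) -> D (u * n%:R) -> 0 <= u ->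
  (0 < m)%N -> D (u * (gcdn m n)%:R).
Proof.
move=> Dm Dn u0 m0; case: (egcdnP n m0) => km kn E _.
have -> : u * (gcdn m n)%:R = u * m%:R * km%:R - u * n%:R * kn%:R.
  by rewrite -!mulrA -!natrM -mulrBr mulnC E natrD [(n * kn)%N]mulnC addrC addKr.
apply: group_likeB; try exact: group_likeMn.
by rewrite -!mulrA -!natrM ler_wpM2l// ler_nat [leqRHS]mulnC E mulnC leq_addr.
Qed.

Hypothesis D_rational : D `<=` range (@ratr R).

(** Both elements are multiples of the inverse [u] of the product of their denominators, and the gcd
    of the two multiplicities gives a divisor that lies in [D]. *)
Lemma group_like_common_divisor x y : D x -> 0 < x -> D y ->
  exists gq : R * nat, [/\ D gq.1, 0 < gq.1, x = gq.1 * (gq.2.+1)%:R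
    & exists k : nat, y = gq.1 * k%:R].
Proof.
move=> Dx x0 Dy; have y0 := group_like_ge0 Dy.
have [r _ rx] := D_rational Dx; have [s _ sy] := D_rational Dy.
have r0 : 0 < numq r by rewrite numq_gt0 -(ltr0q R) rx.
have s0 : 0 <= numq s by rewrite numq_ge0 -(ler0q R) sy.
pose u : R := ((denq r)%:~R * (denq s)%:~R)^-1.
have dr0 : ((denq r)%:~R : R) != 0 by rewrite intr_eq0 denq_neq0.
have ds0 : ((denq s)%:~R : R) != 0 by rewrite intr_eq0 denq_neq0.
have u0 : 0 < u.
  by rewrite /u invr_gt0 mulr_gt0// ltr0z denq_gt0.
pose m := `|(numq r * denq s)%R|%N; pose n := `|(numq s * denq r)%R|%N.
have xm : x = u * m%:R.
  rewrite /m natr_absz ger0_norm ?mulr_ge0 ?(ltW r0) ?denq_ge0// -rx /ratr /u intrM.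
  by field; rewrite dr0 ds0.
have yn : y = u * n%:R.
  rewrite /n natr_absz ger0_norm ?mulr_ge0// ?denq_ge0// -sy /ratr /u intrM.
  by field; rewrite dr0 ds0.
have m0 : (0 < m)%N by rewrite absz_gt0 mulf_neq0// ?denq_neq0// gt_eqF.
have g0 : (0 < gcdn m n)%N by rewrite gcdn_gt0 m0.
exists (u * (gcdn m n)%:R, (m %/ gcdn m n).-1); split => /=.
- by apply: group_like_gcd; rewrite -?xm -?yn// ltW.
- by rewrite mulr_gt0// ltr0n.
- rewrite prednK ?divn_gt0//; last by rewrite dvdn_leq// dvdn_gcdl.
  by rewrite -mulrA -natrM mulnC divnK ?dvdn_gcdl.
- exists (n %/ gcdn m n)%N.
  by rewrite -mulrA -natrM mulnC divnK ?dvdn_gcdr.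
Qed.

Lemma group_like_odometer : exists (a : R) (q : nat -> nat),
  [/\ 0 < a, D = [set t | exists n k : nat, t = a / (odo q n)%:R * k%:R]
    & forall m, exists n, (m < odo q n)%N].
Proof.
have /choice[h hP] : forall xy : R * R, exists gq : R * nat,
    D xy.1 -> 0 < xy.1 -> D xy.2 -> [/\ D gq.1, 0 < gq.1,
    xy.1 = gq.1 * (gq.2.+1)%:R & exists k : nat, xy.2 = gq.1 * k%:R].
  move=> [x y] /=; have [[Dx x0 Dy]|nD] := pselect [/\ D x, 0 < x & D y].
    by have [gq] := group_like_common_divisor Dx x0 Dy; exists gq.
  by exists (0, 0%N) => Dx x0 Dy; exfalso; apply: nD.
(* An enumeration of [D] through the rationals; the default 0 also lies in [D]. *)
pose d n : R := if @choice.unpickle rat n is Some r then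
  if `[< D (ratr r) >] then ratr r else 0 else 0.
have Dd n : D (d n).
  rewrite /d; case: choice.unpickle => [r|]; last exact: group_like0.
  by case: asboolP => // _; exact: group_like0.
have [a0 Da0 a01] := group_like_unbounded 1.
(* [a n.+1] divides both [a n] and [d n], so in the end every element of [D] is a multiple of some
   [a n]. *)
pose a := fix a n : R := if n is m.+1 then (h (a m, d m)).1 else a0.
have aP n : D (a n) /\ 0 < a n.
  elim: n => [|n [Dan an0]] /=; first by split => //; lra.
  by have [] := hP (a n, d n) Dan an0 (Dd n).
pose q n := (h (a n, d n)).2.
have aS n : a n = a n.+1 * (q n).+1%:R.
  by have [Dan an0] := aP n; have [] := hP (a n, d n) Dan an0 (Dd n).
have aodo n : a n = a0 / (odo q n)%:R.
  elim: n => [|n IHn]; first by rewrite divr1.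
  have := odo_gt0 q n; rewrite -(ltr0n R) => o0.
  have qn0 : (q n).+1%:R != 0 :> R by rewrite pnatr_eq0.
  apply: (mulIf qn0); rewrite -aS IHn /= natrM.
  by field; rewrite (gt_eqF o0) nat1r qn0.
have DE : D = [set t | exists n k : nat, t = a0 / (odo q n)%:R * k%:R].
  apply/seteqP; split => t /=; last first.
    by move=> [n [k ->]]; rewrite -aodo; apply: group_likeMn; case: (aP n).
  move=> Dt; have [r _ rt] := D_rational Dt.
  have dt : d (choice.pickle r) = t.
    by rewrite /d choice.pickleK rt; case: asboolP.
  have [Dan an0] := aP (choice.pickle r).
  have [_ _ _ [k /= E]] := hP (_, _) Dan an0 (Dd (choice.pickle r)).
  by exists (choice.pickle r).+1, k; rewrite -aodo -dt.
exists a0, q; split => // [|m]; first lra.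
(* If all [odo q n] were at most [m], nonzero elements of [D] would be at least [a0 / m], and the
   open interval from 0 to [a0 / m] would miss [D], against density. *)
apply: contrapT => nm.
have odom n : (odo q n <= m)%N by rewrite leqNgt; apply/negP => ?; apply: nm; exists n.
have m0 : 0 < m%:R :> R by rewrite ltr0n (leq_trans _ (odom 0%N)).
have a00 : 0 < a0 by lra.
have am0 : 0 < a0 / m%:R by rewrite divr_gt0.
case: D_group_like => _ + _ _ _; move=> /(_ (a0 / m%:R / 2)).
rewrite /= in_itv/= andbT divr_ge0 ?(ltW am0)// => /(_ isT).
move=> /(_ _ (nbhsx_ballx _ (a0 / m%:R / 2) _))[]; first by rewrite divr_gt0.
move=> t []; rewrite DE /= => -[n [[|k] ->]]; rewrite /ball /= ltr_norml => /andP[].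
  by rewrite mulr0; lra.
have : a0 / m%:R <= a0 / (odo q n)%:R * k.+1%:R.
  rewrite -[leLHS]mulr1 ler_pM ?ler1n//; first exact: ltW.
  by rewrite ler_pM2l ?lef_pV2 ?posrE ?m0 ?ltr0n ?odo_gt0 ?ler_nat //.
lra.
Qed.

End group_like_subsets.

(** * The diagram *)

Section odometer_diagram.
Variable q : nat -> nat.
Local Notation M := (odo q).

(* Level [0] consists of [None]; every later level consists of the vertex
   [None] with infinite cylinder and the vertex [Some tt] of the odometers. *)
Definition uvert n : finType := if n is 0 then void else unit.

Definition mkuvert n : option (uvert n) := if n is 0 then None else Some tt.

Lemma uvertE n (u v : uvert n) : u = v.
Proof. by case: n u v => [[]|n [] []]. Qed.

Definition odo_vert n : finType := option (uvert n).

(** [None] continues the path x_inf. The [inl] edges branch off from it, one for each interval of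
    length [1 / M n.+1] in [[n, n + 1[]. The [inr] edges are the digits of the odometers; the factor
    [uvert n] leaves none of them at level 0. *)
Definition odo_edge n : finType :=
  option ('I_(M n.+1) + uvert n * 'I_(q n).+1)%type.

Definition odo_src n (e : odo_edge n) : odo_vert n :=
  if e is Some (inr (u, _)) then Some u else None.

Definition odo_tgt n (e : odo_edge n) : odo_vert n.+1 :=
  if e is Some _ then Some tt else None.

Lemma odo_root_unique (v : odo_vert 0) : v = None.
Proof. by case: v => [[]|]. Qed.

Lemma odo_outgoing n (v : odo_vert n) : exists e, odo_src e = v.
Proof. by case: v => [u|]; [exists (Some (inr (u, ord0)))|exists None]. Qed.

Lemma odo_incoming n (v : odo_vert n.+1) : exists e : odo_edge n, odo_tgt e = v.
Proof.
case: v => [[]|]; last by exists None.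
by exists (Some (inl (Ordinal (odo_gt0 q n.+1)))).
Qed.

Definition odo_diagram : bratteli :=
  @Bratteli odo_vert None odo_root_unique odo_edge odo_src odo_tgt
    odo_outgoing odo_incoming.

Local Notation B := odo_diagram.
Local Notation X := (ipath B).

Lemma odo_diagram_finite_rank : finite_rank B.
Proof.
exists 2 => n; rewrite card_option; case: n => [|n]; first by rewrite card_void.
by rewrite card_unit.
Qed.

(* The paths from the root to [Some tt] at level [n] are numbered from [0] to
   [n * M n - 1], in such a way that those through [Some tt] at level [n - 1]
   come first; [None] is the number of the path that avoids these vertices. *)
Definition code_step n (e : odo_edge n) (c : option nat) : option nat :=
  match e with
  | None => None
  | Some (inl i) => Some (n * M n.+1 + i)%N
  | Some (inr (_, i)) => omap (fun j => j * (q n).+1 + i)%N c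
  end.

Definition valid_code n (v : odo_vert n) (c : option nat) : bool :=
  match v, c with
  | None, None => true
  | Some _, Some j => (j < n * M n)%N
  | _, _ => false
  end.

Lemma valid_code_step n (e : odo_edge n) c :
  valid_code (odo_src e) c -> valid_code (odo_tgt e) (code_step e c).
Proof.
case: e => [[i|[u i]]|] //=; case: c => [j|] //= h.
- by rewrite mulSn addnC ltn_add2r ltn_ord.
- apply: (@leq_trans (j.+1 * (q n).+1)).
    by rewrite mulSn addnC ltn_add2r ltn_ord.
  by rewrite mulnA leq_mul2r (leq_trans h)// leq_mul2r leqnSn orbT.
Qed.

(** A digit is recovered as a remainder modulo [(q n).+1]. Branching edges are numbered from
    [n * M n.+1] on, beyond all continuations of valid codes. *)
Lemma code_step_inj n (e e' : odo_edge n) c c' :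
  valid_code (odo_src e) c -> valid_code (odo_src e') c' ->
  code_step e c = code_step e' c' -> e = e' /\ c = c'.
Proof.
case: e => [[i|[u i]]|]; case: e' => [[i'|[u' i']]|] //=;
  case: c => [j|] //=; case: c' => [j'|] //= h h' [E].
- by split => //; congr (Some (inl _)); apply/val_inj/(addnI E).
- by have := ltn_ord i'; nia.
- by have := ltn_ord i; nia.
- have jj' : j = j'.
    by have := congr1 (divn^~ (q n).+1) E; rewrite !divnMDl// !divn_small ?addn0.
  split; last by rewrite jj'.
  rewrite (uvertE u u'); do 3 congr (_ _); apply/val_inj.
  by move: E; rewrite jj' => /addnI.
Qed.

Fixpoint code n (x : X) : option nat :=
  if n is m.+1 then code_step (x m) (code m x) else None.

Lemma odo_compat n (x : X) :
  odo_tgt (x n : odo_edge n) = odo_src (x n.+1 : odo_edge n.+1).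
Proof. exact: (ip_compat x n). Qed.

Lemma valid_code_tgt n (x : X) : valid_code (odo_tgt (x n)) (code n.+1 x).
Proof.
elim: n => [|n IHn]; apply: valid_code_step.
  by case: (odo_src _) => [[]|].
by rewrite -odo_compat.
Qed.

Lemma valid_code_src n (x : X) : valid_code (odo_src (x n)) (code n x).
Proof.
case: n => [|n]; first by rewrite /=; case: (odo_src _) => [[]|].
by rewrite -odo_compat; exact: valid_code_tgt.
Qed.

Lemma code_bound n (x : X) j : code n x = Some j -> (j < n * M n)%N.
Proof.
by move=> E; have := valid_code_src n x; rewrite E /=; case: (odo_src _).
Qed.

Lemma eq_code n (x y : X) : (forall k, (k < n)%N -> x k = y k) ->
  code n x = code n y.
Proof.
elim: n => //= n IHn xy; rewrite xy// IHn// => k kn.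
by apply: xy; rewrite ltnS ltnW.
Qed.

Lemma code_agree n (x y : X) : code n x = code n y ->
  forall k, (k < n)%N -> x k = y k.
Proof.
elim: n => // n IHn E k.
have [xy cxy] := code_step_inj (valid_code_src n x) (valid_code_src n y) E.
by rewrite ltnS leq_eqVlt => /predU1P[->|]; [exact: xy|exact: IHn].
Qed.

Lemma code_eq_le m n (x y : X) : (m <= n)%N -> code n x = code n y ->
  code m x = code m y.
Proof.
move=> mn /code_agree xy; apply: eq_code => k km.
by apply: xy; exact: leq_trans mn.
Qed.

Lemma ipath_ext (x y : X) : (forall k, x k = y k) -> x = y.
Proof.
case: x y => [f hf] [g hg] /= fg.
have E : f = g by apply: functional_extensionality_dep => k; exact: fg.
by case: _ / E in hg *; congr IPath; exact: Prop_irrelevance.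
Qed.

(** A path that has entered an odometer never leaves it. *)
Lemma code_None_le m n (x : X) : (m <= n)%N -> code n x = None -> code m x = None.
Proof.
move=> /subnK <-; elim: (n - m)%N => //= k IHk.
have := valid_code_src (k + m) x; rewrite /= /code_step.
case: (x _) => [[i|[u i]]|] //=.
- by case: (code (k + m) x).
- by move=> + _; case: (code (k + m) x) IHk => // IHk _; exact: IHk.
Qed.

Fixpoint fpcode n (v : bd_vertex B n) (p : finpath v) : option nat :=
  match p with
  | finpath_nil => None
  | finpath_rcons m e p' => code_step e (fpcode p')
  end.

Lemma valid_fpcode n (v : bd_vertex B n) (p : finpath v) :
  @valid_code n v (fpcode p).
Proof. by elim: p => //= m e p; exact: valid_code_step. Qed.

(** By injectivity of [code_step] the code determines the last edge and the code before it.
    Cylinders can thus be handled as fibres of [code n]. *)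
Lemma cylinderE n (v : bd_vertex B n) (p : finpath v) :
  cylinder p = [set x | code n x = fpcode p].
Proof.
elim: p => [|m e p IHp] /=; first by apply/seteqP; split.
rewrite {}IHp; apply/seteqP; split => x /=.
  by move=> [-> ->].
move=> /code_step_inj []; last by move=> -> ->.
- exact: valid_code_src.
- exact: valid_fpcode.
Qed.

Lemma exists_fpcode n (x : X) :
  exists p : finpath (bd_src (x n)), fpcode p = code n x.
Proof.
elim: n => [|n [p pE]].
  by case: _ / (esym (bd_root_unique (bd_src (x 0%N)))); exists (finpath_nil B).
rewrite -(ip_compat x n); exists (finpath_rcons p).
by rewrite /= pE.
Qed.

(** * Digit expansions of real numbers as paths *)

Section path_of_real.
Context {R : realType}.
Implicit Type t : R.

(** Both sides have the same natural lower bounds. *)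
Lemma divn_truncnM t (m : nat) : 0 <= t -> (0 < m)%N ->
  (Num.truncn (t * m%:R) %/ m)%N = Num.truncn t.
Proof.
move=> t0 m0; have E k : (k <= Num.truncn (t * m%:R) %/ m)%N = (k <= Num.truncn t)%N.
  by rewrite leq_divRL// !truncn_ge_nat ?mulr_ge0// natrM ler_pM2r ?ltr0n.
by apply/eqP; rewrite eqn_leq -E leqnn E leqnn.
Qed.

(** The path of [t] follows x_inf up to the level given by the integer part of [t], branches off
    according to the fractional part cut at precision [1 / M n.+1], and then reads off digits.
    Negative reals are sent to x_inf. The value [None] of [mkuvert 0] is never reached, as [0 <= t]
    there. *)
Definition path_edge t n : odo_edge n :=
  if (t < 0) || (n.+1%:R <= t) then None else
  let j := Num.truncn (t * (M n.+1)%:R) in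
  if n%:R <= t then Some (inl (Ordinal (ltn_pmod j (odo_gt0 q n.+1))))
  else omap (fun u => inr (u, Ordinal (ltn_pmod j (ltn0Sn (q n))))) (mkuvert n).

Lemma path_compat t n : odo_tgt (path_edge t n) = odo_src (path_edge t n.+1).
Proof.
rewrite /path_edge; case: ltrP => //= t0.
have [t1|t1] := lerP n.+1%:R t; first by case: ifP.
have -> : (n.+2%:R <= t) = false.
  by apply/negbTE; rewrite -ltNge (lt_trans t1)// ltr_nat.
have [//|tn] := lerP n%:R t.
by case: n t1 tn => //= _; rewrite ltNge t0.
Qed.

Definition path_of t : X := @IPath B (path_edge t) (path_compat t).

(** The digits are remainders of truncations of [t * M n.+1], so each [code_step] undoes a Euclidean
    division whose quotient is known from [divn_truncnM]. *)
Lemma code_path_of t n : code n (path_of t) =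
  if 0 <= t < n%:R then Some (Num.truncn (t * (M n)%:R)) else None.
Proof.
elim: n => [|n IHn] /=; first by case: ltrP => //; case: lerP.
rewrite {}IHn /= /path_edge.
have -> : (t < 0) || (n.+1%:R <= t) = ~~ (0 <= t < n.+1%:R).
  by rewrite negb_and -ltNge -leNgt.
case: ifP => [/negPf -> //|/negbFE tn]; rewrite tn; case/andP: tn => t0 tn.
rewrite ltNge; case: lerP => tn' /=.
  have tn1 : Num.truncn t = n by apply: truncn_def; rewrite tn' tn.
  congr Some; rewrite [RHS](divn_eq _ (M n.+1)) divn_truncnM ?tn1//.
  exact: (odo_gt0 q n.+1).
rewrite t0; case: n tn tn' => [|n] tn tn' /=; first by rewrite ltNge t0 in tn'.
congr Some; rewrite [RHS](divn_eq _ (q n.+1).+1); congr (_ * _ + _)%N.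
by rewrite [in RHS]natrM mulrA divn_truncnM// mulr_ge0.
Qed.

Lemma code_path_of_preimage n j : (j < n * M n)%N ->
  [set t : R | code n (path_of t) = Some j] =
  `[j%:R / (M n)%:R, j.+1%:R / (M n)%:R[%classic.
Proof.
move=> jn; have M0 : 0 < (M n)%:R :> R by rewrite ltr0n odo_gt0.
apply/seteqP; split => t /=; rewrite code_path_of in_itv/= ler_pdivrMr// ltr_pdivlMr//.
  by case: ifP => // /andP[t0 _] [<-]; apply: truncn_itv; rewrite mulr_ge0// ltW.
move=> tj; rewrite (truncn_def tj); case/andP: tj => jt tj.
rewrite -(pmulr_lge0 _ M0) (le_trans _ jt)//= -(ltr_pM2r M0) (lt_le_trans tj)//.
by rewrite -natrM ler_nat.
Qed.

End path_of_real.

End odometer_diagram.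

(** * Topology of the path space *)

Lemma zero_dimensional_hausdorff (T : topologicalType) :
  zero_dimensional T -> hausdorff_space T.
Proof.
move=> zT; rewrite open_hausdorff => x y /zT[U [[oU cU] Ux nUy]].
exists (U, ~` U); first by split; exact/mem_set.
by split => //=; [exact: closed_openC|rewrite setICr].
Qed.

Section odometer_topology.
Variable q : nat -> nat.
Local Notation M := (odo q).
Local Notation X := (ipath (odo_diagram q)).
Implicit Types (U : set X) (x y : X) (P : pred nat).

(** Fibres of [code n] shrink as [n] grows, so a finite intersection of cylinders around [x]
    contains the fibre of [x] at the largest level involved. *)
Lemma open_code U : open U <->
  forall x, U x -> exists n, [set y | code n y = code n x] `<=` U.
Proof.
split => [[F FD <-] x [A FA Ax]|HU].
  have [S SD SE] := FD _ FA; pose S' : {fset set X} := S.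
  suff [n nA] : exists n, [set y | code n y = code n x] `<=` A.
    by exists n => y /nA; exists A.
  have /choice[m mP] : forall C : set X, exists m, C \in S' ->
      [set y | code m y = code m x] `<=` C.
    move=> C; have [CS|] := boolP (C \in S'); last by exists 0%N.
    have [m [v [p CE]]] := set_mem (SD C CS).
    have : C x by move: Ax; rewrite -SE => /(_ C CS).
    by rewrite CE cylinderE => /= xC; exists m => _ y; rewrite /= xC.
  exists (\max_(C <- enum_fset S') m C)%N => y yx; rewrite -SE => C CS.
  by apply: (mP C CS); apply: code_eq_le yx; exact: leq_bigmax_seq.
have -> : U = \bigcup_(B in [set B | open B /\ B `<=` U]) B.
  apply/seteqP; split => x; last by move=> [B [_ BU] /BU].
  move=> /[dup] Ux /HU[n nU]; exists [set y | code n y = code n x] => //=; split => //.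
  have [p pE] := exists_fpcode n x.
  rewrite -pE -cylinderE; exists [set cylinder p]; last by rewrite bigcup_set1.
  move=> _ ->; exists [fset cylinder p]%fset; last by rewrite set_fset1 bigcap_set1.
  by move=> C; rewrite inE => /eqP ->; apply/mem_set; exists n, _, p.
by apply: bigcup_open => B [].
Qed.

Lemma open_codeP n (Q : set (option nat)) : open [set x : X | Q (code n x)].
Proof. by apply/open_code => x Qx; exists n => y /= ->. Qed.

Lemma clopen_codeP n (Q : set (option nat)) : clopen [set x : X | Q (code n x)].
Proof.
split; first exact: open_codeP; rewrite -[X in closed X]setCK.
exact/open_closedC/(@open_codeP n (~` Q)).
Qed.

Lemma code_neq x y : x != y -> exists n, code n x <> code n y.
Proof.
apply: contra_neqP => nxy; apply: ipath_ext => k.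
apply: (@code_agree _ k.+1) => //; apply: contrapT => xy.
by apply: nxy; exists k.+1.
Qed.

(** Otherwise [F] would contain the complements of all the fibres, which are finite in number and
    have no common point. *)
Lemma ultra_finite (T : Type) (F : set_system T) (E : finType) (g : T -> E) :
  UltraFilter F -> exists e, F [set x | g x = e].
Proof.
move=> FU; apply: contrapT => /forallNP nF.
have /filter_forall : forall e, F [set x | g x <> e].
  by move=> e; have [/nF|] := in_ultra_setVsetC [set x | g x = e] FU.
by move=> /filter_ex[x /(_ (g x))].
Qed.

Lemma compact_ipath : compact [set: X].
Proof.
rewrite compact_ultra => F FU _.
(* The limit takes at each level the edge on which the ultrafilter concentrates; successive edges
   match since the two sets in [F] meet. *)
pose e k := projT1 (cid (@ultra_finite _ F _ (fun x => x k) FU)).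
have eF k : F [set x : X | x k = e k] by rewrite /e; case: cid.
have ee k : bd_tgt (e k) = bd_src (e k.+1).
  have [x [/= xk xk1]] :
      [set x : X | x k = e k] `&` [set x : X | x k.+1 = e k.+1] !=set0.
    have FP : ProperFilter F by exact: ultra_proper.
    have := @filter_ex _ F FP _ (@filterI _ F _ _ _ (eF k) (eF k.+1)).
    by move=> [x]; exists x.
  by rewrite -xk -xk1; exact: (ip_compat x k).
exists (IPath ee); split => // A; rewrite nbhsE => -[U [oU Uy] UA].
have [n nU] := (open_code U).1 oU _ Uy.
have /filter_forall : forall k : 'I_n, F [set x : X | x k = e k] by move=> k.
apply: filterS => x xe; apply/UA/nU/eq_code => k kn.
exact: (xe (Ordinal kn)).
Qed.

Lemma zero_dimensional_ipath : zero_dimensional X.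
Proof.
move=> x y /code_neq[n nxy]; exists [set z | code n z = code n x].
split => //; first exact: (clopen_codeP n [set code n x]).
by move=> /esym.
Qed.

(** Around each point membership in [U] is decided at some level; compactness makes the level
    uniform. *)
Lemma clopen_code U : clopen U -> exists n, forall m, (n <= m)%N ->
  forall x y, code m x = code m y -> U x -> U y.
Proof.
move=> [oU cU].
have : \forall n \near \oo, [set: X] `<=`
    (fun n x => forall y, code n x = code n y -> U x -> U y) n.
  have/compact_near_coveringP := compact_ipath; apply => x _.
  have [n nP] : exists n, forall y z, code n y = code n x -> code n z = code n x ->
      U y -> U z.
    have [Ux|nUx] := pselect (U x).
      by have [n nU] := (open_code U).1 oU _ Ux; exists n => y z _ /nU.
    have [n nU] := (open_code (~` U)).1 (closed_openC cU) _ nUx.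
    by exists n => y z /nU.
  exists ([set y | code n y = code n x], [set m | (n <= m)%N]).
    split => /=; last exact: nbhs_infty_ge.
    by apply: open_nbhs_nbhs; split => //; exact: (open_codeP n [set code n x]).
  move=> [y m] /= [yx nm] z yz; apply: nP => //.
  by rewrite -yx; apply/esym; exact: code_eq_le yz.
move=> [n _ nP]; exists n => m nm x y; exact: (nP m nm x I).
Qed.

Definition path_inf : X :=
  @IPath (odo_diagram q) (fun k => (None : odo_edge q k)) (fun=> erefl).

Lemma code_path_inf n : code n path_inf = None.
Proof. by elim: n. Qed.

Lemma path_inf_neq x : x <> path_inf -> exists n j, code n x = Some j.
Proof.
move=> /eqP/code_neq[n]; rewrite code_path_inf => nx.
by exists n; case: (code n x) nx => [j|//] _; exists j.
Qed.

(** The default [false] leaves out the cylinder of [path_inf], the only one of infinite measure. *)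
Definition codeset n P : set X := [set x | oapp P false (code n x)].

Lemma clopen_codeset n P : clopen (codeset n P).
Proof. exact: (clopen_codeP n (fun c => oapp P false c)). Qed.

Lemma codeset_path_inf n P : ~ codeset n P path_inf.
Proof. by rewrite /codeset /= code_path_inf. Qed.

Lemma clopen_codesetE U : clopen U -> exists n, forall m, (n <= m)%N ->
  [/\ exists P, U `&` codeset m predT = codeset m P,
      ~ U path_inf -> U `<=` codeset m predT
    & U path_inf -> [set x : X | code m x = None] `<=` U].
Proof.
move=> /clopen_code[n nU]; exists n => m /nU{}nU; split.
- exists (fun j => `[< exists2 y, U y & code m y = Some j >]).
  apply/seteqP; split => x; rewrite /codeset/=.
    by move=> [Ux]; case E : (code m x) => [j|//] _ /=; apply/asboolP; exists x.
  case E : (code m x) => [j|//] /= /asboolP[y Uy yj].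
  by split => //; apply: nU Uy; rewrite yj E.
- move=> nUinf x Ux; rewrite /codeset/=; case E : (code m x) => [//|] /=.
  by exfalso; apply: nUinf; apply: nU Ux; rewrite E code_path_inf.
- by move=> Uinf x /= E; apply: nU Uinf; rewrite E code_path_inf.
Qed.

End odometer_topology.

(** * The measure *)

Section odometer_measure.
Context {R : realType}.
Variable q : nat -> nat.
Local Notation M := (odo q).
Local Notation X := (ipath (odo_diagram q)).
Local Notation path := (@path_of q R).

Lemma measurable_path_code n (c : option nat) :
  measurable [set t : measurableTypeR R | code n (path t) = c].
Proof.
case: c => [j|].
  have [jn|nj] := ltnP j (n * M n).
    by rewrite code_path_of_preimage; first exact: measurable_itv.
  rewrite (_ : mkset _ = set0) // -subset0 => t /= /code_bound.
  by rewrite ltnNge nj.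
have -> : [set t : measurableTypeR R | code n (path t) = None] = ~` `[0, n%:R[%classic.
  by apply/seteqP; split => t /=; rewrite code_path_of in_itv/=; case: ifP.
by apply: measurableC; exact: measurable_itv.
Qed.

Lemma measurable_path_of :
  measurable_fun [set: measurableTypeR R] (path : _ -> borel X).
Proof.
apply: measurability; first by reflexivity.
move=> _ [U oU <-]; rewrite setTI.
(* Putting the inclusion in [U] inside the set makes [F n c] empty or a full preimage, so the
   preimage of [U] is a union over all [n] and [c]. *)
pose F n c := [set t : measurableTypeR R |
  [set y | code n y = c] `<=` U /\ code n (path t) = c].
have mF n c : measurable (F n c).
  have [cU|ncU] := pselect ([set y : X | code n y = c] `<=` U).
    have -> : F n c = [set t | code n (path t) = c].
      by apply/seteqP; split => t /=; [case|split].
    exact: measurable_path_code.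
  by rewrite (_ : F n c = set0)// -subset0 => t [].
have -> : path @^-1` U = \bigcup_n (F n None `|` \bigcup_j F n (Some j)).
  apply/seteqP; split => t /=.
    move=> /((open_code U).1 oU)[n nU]; exists n => //.
    case E : (code n (path t)) nU => [j|] nU; last by left.
    by right; exists j.
  by move=> [n _ [[+ /= tn]|[j _ [+ /= tn]]]]; apply.
apply: bigcupT_measurable => n; apply: measurableU => //.
exact: bigcupT_measurable.
Qed.

(** The Lebesgue measure is restricted to this set because negative reals all map to [path_inf] and
    would give that point infinite mass. *)
Lemma measurable_nonneg : measurable ([set t | 0 <= t] : set (measurableTypeR R)).
Proof.
rewrite (_ : mkset _ = `[0, +oo[%classic); first exact: measurable_itv.
by apply/seteqP; split => t; rewrite /= in_itv/= andbT.
Qed.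

Lemma exists_odo_measure (a : R) : 0 <= a ->
  exists mu : {measure set (borel X) -> \bar R}, forall A,
    mu A = (a%:E * lebesgue_measure [set t : R | A (path t) /\ (0 <= t)%R])%E.
Proof.
(* [pushforward] takes no measurability proof, so its measure structure cannot
   be inferred and is given by name. *)
move=> a0; pose nu := mrestr (@lebesgue_measure R) measurable_nonneg.
by exists (mscale (NngNum a0)
  (measure_function_pushforward__canonical__measure_function_Measure
    nu measurable_path_of)).
Qed.
End odometer_measure.

(** Translation preserves the length of half-open intervals, which determines the Lebesgue
    measure. *)
Lemma lebesgue_measure_shift {R : realType} (c : R) (A : set R) :
  measurable (A : set (measurableTypeR R)) ->
  lebesgue_measure [set t | A (t + c)] = lebesgue_measure A.
Proof.
move=> mA; have mc : measurable_fun [set: measurableTypeR R]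
    ((fun t => t + c) : measurableTypeR R -> measurableTypeR R).
  by apply: measurable_realfun.measurable_funD => //; exact: measurable_id.
have := @lebesgue_measure_unique R
  (measure_function_pushforward__canonical__measure_function_Measure
    lebesgue_measure mc).
move=> /(_ _ _ mA)/esym; apply => _ [[x y]] _ <-.
rewrite /= /pushforward (_ : _ @^-1` _ = `]x - c, y - c]%classic).
  rewrite !lebesgue_measure_itv/= !lte_fin ltrD2r; case: ifP => // _.
  by rewrite -!EFinB; congr (_%:E); ring.
by apply/seteqP; split => t /=; rewrite !in_itv/= ltrBlDr lerBrDr.
Qed.

(** * Values on cylinders and tail invariance *)

Section odometer_measure_properties.
Context {R : realType} {q : nat -> nat} {a : R}.
Local Notation M := (odo q).
Local Notation X := (ipath (odo_diagram q)).
Local Notation path := (@path_of q R).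
Local Notation codeset := (@codeset q).
Variable mu : {measure set (borel X) -> \bar R}.
Hypothesis a_gt0 : 0 < a.
Hypothesis muE : forall A,
  mu A = (a%:E * lebesgue_measure [set t : R | A (path t) /\ (0 <= t)%R])%E.
Implicit Types (A U V : set X) (x y : X) (P : pred nat).

Let M0 n : 0 < (M n)%:R :> R. Proof. by rewrite ltr0n odo_gt0. Qed.

Lemma measurable_clopen U : clopen U -> measurable (U : set (borel X)).
Proof. by move=> [oU _]; exact: sub_sigma_algebra. Qed.

Lemma measurable_codeset n P : measurable (codeset n P : set (borel X)).
Proof. by apply: measurable_clopen; exact: clopen_codeset. Qed.

Lemma odo_measure_code n j : (j < n * M n)%N ->
  mu [set x | code n x = Some j] = (a / (M n)%:R)%:E.
Proof.
move=> jn; rewrite muE (_ : [set t | _ /\ _] = [set t : R | code n (path t) = Some j]).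
  rewrite code_path_of_preimage// lebesgue_measure_itv/= lte_fin.
  rewrite ltr_pM2r ?invr_gt0// ltr_nat ltnSn -EFinB -EFinM -natr1.
  by congr (_%:E); ring.
apply/seteqP; split => t /=; first by case.
by move=> /[dup] + ->; rewrite code_path_of; case: ifP => // /andP[].
Qed.

(** Stated for an arbitrary [nu] because ergodicity applies it to the restriction of [mu] to a
    tail-invariant set. *)
Lemma measure_codeset (nu : {measure set (borel X) -> \bar R}) (r : R) n P :
  (forall j, (j < n * M n)%N -> nu [set x | code n x = Some j] = r%:E) ->
  nu (codeset n P) = (r * (count P (iota 0 (n * M n)))%:R)%:E.
Proof.
move=> nur.
suff H N : (N <= n * M n)%N ->
    nu (codeset n [pred j | (j < N)%N && P j]) = (r * (count P (iota 0 N))%:R)%:E.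
  rewrite -H//; congr (nu _); apply/seteqP; split => x; rewrite /codeset/=.
    by case E : (code n x) => [j|]//= ->; rewrite (code_bound E).
  by case E : (code n x) => [j|]//= /andP[].
elim: N => [_|N IHN Nn].
  rewrite mulr0 (_ : codeset _ _ = set0) ?measure0//.
  by rewrite -subset0 => x; rewrite /codeset/=; case: (code n x).
rewrite -addn1 iotaD count_cat natrD mulrDr /= addn0 add0n.
have -> : codeset n [pred j | (j < N + 1)%N && P j] =
    codeset n [pred j | (j < N)%N && P j] `|` codeset n [pred j | (j == N) && P j].
  apply/seteqP; split => x; rewrite /codeset/=; case: (code n x) => [j|]//=;
    last by case.
  - by rewrite addn1 ltnS [(j <= N)%N]leq_eqVlt => /andP[/orP[] -> ->]; [right|left].
  - by rewrite addn1 ltnS [(j <= N)%N]leq_eqVlt => -[] /andP[-> ->]; rewrite ?orbT.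
rewrite measureU; first last.
- rewrite -subset0 => x; rewrite /codeset/= => -[].
  by case: (code n x) => [j|]//= /andP[jN _] /andP[/eqP jE]; rewrite jE ltnn in jN.
- exact: measurable_codeset.
- exact: measurable_codeset.
rewrite /= IHN ?(ltnW Nn)// EFinD; congr (_ + _)%E; case PN : (P N).
  rewrite mulr1 -(nur N)//; congr (nu _); apply/seteqP; split => x; rewrite /codeset/=.
    by case: (code n x) => [j|]//= /andP[/eqP ->].
  by move=> -> /=; rewrite eqxx.
rewrite mulr0 (_ : codeset _ _ = set0) ?measure0//.
rewrite -subset0 => x; rewrite /codeset/=; case: (code n x) => [j|]//=.
by move=> /andP[/eqP ->]; rewrite PN.
Qed.

Lemma odo_measure_codeset n P :
  mu (codeset n P) = (a / (M n)%:R * (count P (iota 0 (n * M n)))%:R)%:E.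
Proof. exact/measure_codeset/odo_measure_code. Qed.

Lemma odo_measure_codesetT n : mu (codeset n predT) = (a * n%:R)%:E.
Proof.
rewrite odo_measure_codeset count_predT size_iota natrM; congr (_%:E).
by field; rewrite gt_eqF.
Qed.

Lemma odo_measure_path_inf : mu [set path_inf q] = 0%E.
Proof.
rewrite muE (_ : [set t | _ /\ _] = set0) ?measure0 ?mule0// -subset0 => t /= [E t0].
(* The path of [t] has left x_inf by the level just above the integer part of [t]. *)
have := code_path_inf q (Num.truncn t).+1; rewrite -E code_path_of t0.
by have /andP[_ ->] := truncn_itv t0.
Qed.

Lemma measurable_code n (c : option nat) :
  measurable ([set x : X | code n x = c] : set (borel X)).
Proof. by apply: measurable_clopen; exact: (clopen_codeP q n [set c]). Qed.

Lemma odo_measure_code_None n : mu [set x | code n x = None] = +oo%E.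
Proof.
rewrite muE (_ : [set t | _ /\ _] = `[n%:R, +oo[%classic).
  by rewrite lebesgue_measure_itv/= ltry gt0_muley ?lte_fin.
apply/seteqP; split => t /=; rewrite in_itv/= andbT code_path_of.
  by move=> [+ t0]; rewrite t0/=; case: ltP.
by move=> nt; rewrite ltNge nt andbF (le_trans _ nt).
Qed.

(** For [n <= k], adding [i / M n] to [t] changes [t * M k.+1] by a multiple of [(q k).+1], which
    does not affect the digit at place [k]. Two natural shifts stand for one signed shift. *)
Lemma path_tail (t t' : R) n k i j : 0 <= t < n%:R -> 0 <= t' < n%:R ->
  t * (M n)%:R + i%:R = t' * (M n)%:R + j%:R -> (n <= k)%N ->
  path t k = path t' k.
Proof.
have truncnDn (x : R) m : 0 <= x -> Num.truncn (x + m%:R) = (Num.truncn x + m)%N.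
  move=> x0; apply: truncn_def; have := truncn_itv x0.
  by rewrite -addSn !natrD lerD2r ltrD2r.
have edgeE (s : R) : 0 <= s < n%:R -> (n <= k)%N -> path_edge q s k =
    omap (fun u => inr (u, Ordinal (ltn_pmod
      (Num.truncn (s * (M k.+1)%:R)) (ltn0Sn (q k))))) (mkuvert k).
  move=> /andP[s0 sn] nk; rewrite /path_edge.
  have sk : s < k%:R by rewrite (lt_le_trans sn)// ler_nat.
  have sk1 : s < k.+1%:R by rewrite (lt_trans sk)// ltr_nat.
  by rewrite ltNge s0 !leNgt sk1 sk.
move=> tn tn' E nk; rewrite /= !edgeE//; case: (mkuvert k) => //= u.
congr (Some (inr (u, _))); apply/val_inj => /=.
have [l kl] := odo_dvd q nk; rewrite kl.
case/andP: tn => t0 _; case/andP: tn' => t'0 _.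
rewrite -(modnMDl (i * l)) addnC -truncnDn ?mulr_ge0//.
rewrite -[RHS](modnMDl (j * l)) addnC -truncnDn ?mulr_ge0//.
congr (Num.truncn _ %% _)%N.
by rewrite !natrM !mulrA -!mulrDl E.
Qed.

Lemma odo_measure_tail_invariant : tail_invariant_measure mu.
Proof.
move=> n v p p' A mA Ap.
have pE := cylinderE p; have p'E := cylinderE p'.
have tail_eq x y : code n x = code n y ->
    (forall k, (n <= k)%N -> x k = y k) -> x = y.
  move=> /code_agree xy xy'; apply: ipath_ext => k.
  by have [kn|nk] := ltnP k n; [exact: xy|exact: xy'].
have := valid_fpcode p; have := valid_fpcode p'.
case: v p p' pE p'E Ap => [u|] p p' pE p'E Ap; last first.
  (* Over [None] both paths have code [None], so the replacement changes nothing. *)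
  case pc' : (fpcode p') => [//|] _; case pc : (fpcode p) => [//|] _.
  congr (mu _); rewrite /replace_prefix p'E pc'; apply/seteqP; split => y.
    move=> [/= yn [x Ax yx]]; suff -> : y = x by [].
    by apply: tail_eq => //; have := Ap x Ax; rewrite pE pc /= yn => ->.
  move=> Ay; split; last by exists y.
  by have := Ap y Ay; rewrite pE pc.
case pc' : (fpcode p') => [j|//] jn; case pc : (fpcode p) => [i|//] iM.
rewrite !muE; congr (_ * _)%E.
(* Translation by [c] carries the interval of code [j] onto that of code [i] and preserves the later
   digits; it realizes the change of prefix on the reals. *)
pose c : R := (i%:R - j%:R) / (M n)%:R.
have cM : c * (M n)%:R = i%:R - j%:R by rewrite /c divfK// gt_eqF.
have codei t : code n (path (t + c)) = Some i <-> code n (path t) = Some j.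
  have /seteqP[ci ic] := @code_path_of_preimage q R n i iM.
  have /seteqP[cj jc] := @code_path_of_preimage q R n j jn.
  have E : (t + c \in `[i%:R / (M n)%:R, i.+1%:R / (M n)%:R[) =
      (t \in `[j%:R / (M n)%:R, j.+1%:R / (M n)%:R[).
    rewrite !in_itv/= !ler_pdivrMr// !ltr_pdivlMr// mulrDl cM -!natr1.
    by congr (_ && _); apply/idP/idP; lra.
  split => [/ci|/cj] /=; first by rewrite E => /jc.
  by rewrite -E => /ic.
have range t (l : nat) : code n (path t) = Some l -> 0 <= t < n%:R.
  by rewrite code_path_of; case: ifP.
have tails t : code n (path t) = Some j ->
    forall k, (n <= k)%N -> path (t + c) k = path t k.
  move=> tj k nk; apply: (@path_tail _ _ n k j i) => //.
  - by apply: range; apply/codei.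
  - exact: range tj.
  - by rewrite mulrDl cM; ring.
rewrite -[RHS](lebesgue_measure_shift c); last first.
  apply: measurableI; last exact: measurable_nonneg.
  by rewrite -[X in measurable X]setTI; exact: (@measurable_path_of R q _ _ mA).
congr (lebesgue_measure _); apply/seteqP; split => t /=.
  move=> [[]]; rewrite p'E pc' /= => tj [x Ax tx] t0.
  have ti : code n (path (t + c)) = Some i by apply/codei.
  suff -> : path (t + c) = x by have /andP[] := range _ _ ti.
  apply: tail_eq; first by have := Ap x Ax; rewrite pE pc /= ti => ->.
  by move=> k nk; exact: etrans (tails _ tj _ nk) (tx _ nk).
move=> [Atc tc0]; have := Ap _ Atc; rewrite pE pc /= => /codei tj.
have /andP[-> _] := range _ _ tj.
split => //; split; first by rewrite p'E pc'.
by exists (path (t + c)) => // k nk; rewrite tails.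
Qed.

End odometer_measure_properties.

Lemma code_src (q : nat -> nat) n (x : ipath (odo_diagram q)) (u : uvert n) j :
  code n x = Some j ->
  bd_src (x n) = Some u :> bd_vertex (odo_diagram q) n.
Proof.
move=> xj; have := valid_code_src n x; rewrite xj /=.
by case: (odo_src _) => // u' _; rewrite (uvertE u' u).
Qed.

Lemma code_finpath (q : nat -> nat) n (x : ipath (odo_diagram q)) (u : uvert n) j :
  code n x = Some j ->
  exists p : finpath (Some u : bd_vertex (odo_diagram q) n), fpcode p = Some j.
Proof.
move=> xj; have [p] := exists_fpcode n x; rewrite xj.
by case: _ / (code_src u xj) in p * => pj; exists p.
Qed.

Lemma count_mem_subseq (s t : seq nat) : uniq t -> subseq s t ->
  count (mem s) t = size s.
Proof. by move=> ut /(subseq_uniqP ut) {2}->; rewrite size_filter. Qed.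

(** * Non-defectiveness, goodness and the clopen values *)

Section odometer_measure_good.
Context {R : realType} {q : nat -> nat} {a : R}.
Local Notation M := (odo q).
Local Notation X := (ipath (odo_diagram q)).
Local Notation path := (@path_of q R).
Local Notation codeset := (@codeset q).
Variable mu : {measure set (borel X) -> \bar R}.
Hypothesis a_gt0 : 0 < a.
Hypothesis muE : forall A,
  mu A = (a%:E * lebesgue_measure [set t : R | A (path t) /\ (0 <= t)%R])%E.
Hypothesis M_unbounded : forall m, exists n, (m < M n)%N.
Implicit Types (A U V : set X) (x y : X) (P : pred nat).

Let M0 n : 0 < (M n)%:R :> R. Proof. by rewrite ltr0n odo_gt0. Qed.

Let mu_code n j := @odo_measure_code R q a mu muE n j.
Let mu_codeset n P := @odo_measure_codeset R q a mu muE n P.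
Let mu_codesetT n := @odo_measure_codesetT R q a mu muE n.
Let mu_None n := @odo_measure_code_None R q a mu a_gt0 muE n.
Let mu_inf := @odo_measure_path_inf R q a mu muE.

Lemma le_odo_measure A A' : measurable (A : set (borel X)) ->
  measurable (A' : set (borel X)) -> A `<=` A' -> (mu A <= mu A')%E.
Proof. by move=> mA mA' AA'; apply: le_measure => //; exact: mem_set. Qed.

Lemma odo_measure_ball_gt0 n x : (0 < mu [set y | code n y = code n x])%E.
Proof.
case E : (code n x) => [j|]; last by rewrite mu_None.
by rewrite mu_code ?(code_bound E)// lte_fin divr_gt0.
Qed.

Lemma odo_measure_full : full_measure (mu : set X -> \bar R).
Proof.
move=> U oU [x Ux]; have [n nU] := (open_code U).1 oU x Ux.
apply: lt_le_trans (odo_measure_ball_gt0 n x) _.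
by apply: le_odo_measure => //; [exact: measurable_code|exact: sub_sigma_algebra].
Qed.

Lemma clopen_infinite U : clopen U -> U (path_inf q) -> mu U = +oo%E.
Proof.
move=> cU Uinf; have [n /(_ n (leqnn n))[_ _ /(_ Uinf) nU]] := clopen_codesetE cU.
apply/eqP; rewrite -leye_eq -(mu_None n).
by apply: le_odo_measure => //; [exact: measurable_code|exact: measurable_clopen].
Qed.

Lemma clopen_finite U : clopen U -> (mu U < +oo)%E ->
  exists n, forall m, (n <= m)%N -> exists P, U = codeset m P.
Proof.
move=> cU Uoo; have nUinf : ~ U (path_inf q).
  by move=> /(clopen_infinite cU) E; rewrite E ltxx in Uoo.
have [n nU] := clopen_codesetE cU.
exists n => m /nU[[P PE] /(_ nUinf)/setIidPl UE _].
by exists P; rewrite -PE UE.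
Qed.

(** An isolated point would be a whole code fibre at all large levels. For [path_inf] such fibres
    have infinite measure but the point is null; for other points the mass [a / M m] would be
    constant in [m], while [M] is unbounded. *)
Lemma perfect_ipath : perfect_set [set: X].
Proof.
apply/perfectTP => x ox; have [n nx] := (open_code _).1 ox x erefl.
have xE m : (n <= m)%N -> [set y | code m y = code m x] = [set x].
  move=> nm; apply/seteqP; split => [y yx|_ -> //]; apply: nx.
  exact: code_eq_le yx.
have [xinf|/path_inf_neq[k [j kj]]] := pselect (x = path_inf q).
  have := mu_None n; rewrite -(code_path_inf q n) -xinf xE// xinf.
  by rewrite mu_inf.
have [l lM] := M_unbounded (M (maxn n k)).
have xM m : (maxn n k <= m)%N -> mu [set x] = (a / (M m)%:R)%:E.
  move=> nkm; rewrite -(xE m); last exact: leq_trans (leq_maxl _ _) nkm.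
  have : code m x <> None.
    move=> /(code_None_le (leq_trans (leq_maxr _ _) nkm)).
    by rewrite kj.
  by case E : (code m x) => [i|//] _; rewrite mu_code// (code_bound E).
have := xM _ (leqnn _); rewrite (xM (maxn (maxn n k) l)) ?leq_maxl// => -[].
move=> /(mulfI (lt0r_neq0 a_gt0))/invr_inj/eqP; rewrite eqr_nat => /eqP E.
by have := leq_odo q (leq_maxr (maxn n k) l); rewrite E leqNgt lM.
Qed.

Lemma cantor_like_ipath : cantor_like X.
Proof.
have zX := @zero_dimensional_ipath q.
split => //; [exact: perfect_ipath|exact: compact_ipath|].
exact: zero_dimensional_hausdorff.
Qed.

Lemma path_inf_bigcap :
  [set path_inf q] = ~` \bigcup_n codeset n predT.
Proof.
apply/seteqP; split => x /=.
  by move=> -> [n _]; exact: codeset_path_inf.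
move=> nx; apply: contrapT => /path_inf_neq[n [j nj]].
by apply: nx; exists n => //; rewrite /codeset/= nj.
Qed.

Lemma measurable_path_inf : measurable ([set path_inf q] : set (borel X)).
Proof.
rewrite path_inf_bigcap; apply: measurableC; apply: bigcupT_measurable => n.
exact: measurable_codeset.
Qed.

(** [A] is cut along fibres of mass less than [mu A]. If all the pieces were null, [A] would be
    null, since apart from [path_inf] they cover it. *)
Lemma odo_measure_nonatomic : nonatomic (mu : set X -> \bar R).
Proof.
move=> A mA muA.
have [N aN] : exists N, ((a / (M N)%:R)%:E < mu A)%E.
  have [r r0 rA] : exists2 r : R, 0 < r & (r%:E <= mu A)%E.
    case: (mu A) muA => [r r0|_|//]; first by exists r.
    by exists 1; rewrite ?leey.
  have [N aN] := M_unbounded (Num.truncn (a / r)).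
  exists N; apply: lt_le_trans rA; rewrite lte_fin ltr_pdivrMr// mulrC -ltr_pdivrMr//.
  have /andP[_ /lt_le_trans] := truncn_itv (ltW (divr_gt0 a_gt0 r0)).
  by apply; rewrite ler_nat.
(* Levels start at [N], so that every fibre has mass at most [a / M N]. *)
pose B n j := A `&` [set x | code (n + N) x = Some j].
have mB n j : measurable (B n j : set (borel X)).
  by apply: measurableI => //; exact: measurable_code.
have [[n [j nj]]|nB] := pselect (exists n j, (0 < mu (B n j))%E).
  exists (B n j); split; [exact: mB|by move=> x []|exact: nj|].
  apply: le_lt_trans aN; apply: (@le_trans _ _ (mu [set x | code (n + N) x = Some j])).
    by apply: le_odo_measure; [exact: mB|exact: measurable_code|move=> x []].
  have [jn|jn] := ltnP j ((n + N) * M (n + N)).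
    rewrite mu_code// lee_fin ler_pM2l// lef_pV2 ?posrE// ler_nat.
    by rewrite leq_odo// leq_addl.
  rewrite (_ : mkset _ = set0) ?measure0 ?lee_fin ?divr_ge0 ?ltW//.
  by rewrite -subset0 => x /= /code_bound; rewrite ltnNge jn.
suff A0 : mu.-negligible (A : set (borel X)).
  by have /(negligibleP mu mA) A00 := A0; rewrite A00 ltxx in muA.
have AB : A `<=` \bigcup_n \bigcup_j B n j `|` [set path_inf q].
  move=> x Ax; have [->|/path_inf_neq[n [j nj]]] := pselect (x = path_inf q).
    by right.
  left; exists n => //; case E : (code (n + N) x) => [i|]; first by exists i.
  by have := code_None_le (leq_addr N n) E; rewrite nj.
refine (@negligibleS _ (borel X) R mu _ _ AB _).
apply: negligibleU; last by apply/negligibleP => //; exact: measurable_path_inf.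
apply: negligible_bigcup => n; apply: negligible_bigcup => j.
apply/negligibleP => //; apply/eqP; rewrite eq_le measure_ge0 andbT leNgt.
by apply/negP => ?; apply: nB; exists n, j.
Qed.

Lemma odo_measure_setT : mu setT = +oo%E.
Proof.
rewrite -(mu_None 0); congr (mu _).
by apply/seteqP; split.
Qed.

Lemma odo_measure_defective : defective_set (mu : set X -> \bar R) = [set path_inf q].
Proof.
apply/seteqP; split => x /=; last by move=> -> U cU; exact: clopen_infinite.
move=> xoo; apply: contrapT => /path_inf_neq[n [j nj]].
have := xoo _ (clopen_codeset q n predT).
by rewrite mu_codesetT /codeset/= nj => /(_ isT).
Qed.

Lemma odo_measure_nondefective : nondefective (mu : set X -> \bar R).
Proof.
split; [exact: cantor_like_ipath|exact: odo_measure_full|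
  exact: odo_measure_nonatomic|exact: odo_measure_setT|].
by rewrite odo_measure_defective mu_inf.
Qed.

Lemma odo_measure_good : good_infinite_measure (mu : set X -> \bar R).
Proof.
split; first exact: odo_measure_nondefective.
move=> U V cU cV UV.
have [n nU] := clopen_finite cU (lt_le_trans UV (leey _)).
have [n' nV] := clopen_codesetE cV.
(* A common level at which the part of [V] made of odometer cylinders is already as large as [U];
   this needs work only when [V] contains [path_inf] and has infinite measure. *)
have [m [nm n'm UVm]] : exists m, [/\ (n <= m)%N, (n' <= m)%N
    & (mu U <= mu (V `&` codeset m predT))%E].
  have [Vinf|nVinf] := pselect (V (path_inf q)); last first.
    exists (maxn n n'); split; rewrite ?leq_maxl ?leq_maxr//.
    have [_ /(_ nVinf)/setIidPl -> _] := nV _ (leq_maxr n n').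
    exact: ltW.
  have [P UE] := nU n (leqnn n).
  (* [V] contains everything outside [codeset n' predT], hence mass at least [a * (k - n')] at this
     level, and [mu U] is at most [a * (n * M n)]. *)
  pose k := (n' + n * M n)%N; exists (maxn n k); split.
  - exact: leq_maxl.
  - by rewrite leq_max leq_addr orbT.
  have [_ _ /(_ Vinf) n'V] := nV _ (leqnn n').
  have : (mu (codeset (maxn n k) predT) <=
      mu (V `&` codeset (maxn n k) predT) + mu (codeset n' predT))%E.
    apply: le_trans (measureU2 _ _ _); try exact: measurable_codeset; last first.
      by apply: measurableI; [exact: measurable_clopen|exact: measurable_codeset].
    apply: le_odo_measure; first exact: measurable_codeset.
      apply: measurableU; last exact: measurable_codeset.
      by apply: measurableI; [exact: measurable_clopen|exact: measurable_codeset].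
    move=> x xk; case E : (code n' x) => [j|]; last by left; split => //; exact: n'V.
    by right; rewrite /codeset/= E.
  rewrite !mu_codesetT => H.
  have : ((a * (n * M n)%:R)%:E <= mu (V `&` codeset (maxn n k) predT))%E.
    rewrite -leeBlDr// -EFinB -mulrBr in H; apply: le_trans H.
    rewrite lee_fin ler_pM2l// lerBrDr -natrD ler_nat.
    by rewrite addnC leq_maxr.
  apply: le_trans; rewrite UE mu_codeset lee_fin.
  rewrite -mulrA ler_pM2l// mulrC ler_pdivrMr// -natrM ler_nat.
  by rewrite (leq_trans (count_size _ _))// size_iota leq_pmulr// odo_gt0.
have [P UE] := nU m nm; have [[P' VE] _ _] := nV m n'm.
(* All odometer cylinders of level [m] have the same mass, so it suffices to take as many of those
   in [V] as [U] has. *)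
pose it := iota 0 (m * M m); pose s := take (count P it) (seq.filter P' it).
have PP' : (count P it <= count P' it)%N.
  move: UVm; rewrite UE VE !mu_codeset lee_fin ler_pM2l ?divr_gt0//.
  by rewrite ler_nat.
have sP' : subseq s it.
  exact: subseq_trans (take_subseq _ _) (filter_subseq _ _).
exists (codeset m (mem s)); split; first exact: clopen_codeset.
- apply: (@subset_trans _ (codeset m P')); last by rewrite -VE; exact: subIsetl.
  move=> x; rewrite /codeset/=; case: (code m x) => [j|]//= /mem_take.
  by rewrite mem_filter => /andP[].
- rewrite UE !mu_codeset count_mem_subseq ?iota_uniq// size_take_min.
  by rewrite size_filter (minn_idPl PP').
Qed.

Lemma odo_measure_clopen_values : clopen_values (mu : set X -> \bar R) =
  [set t | exists n k : nat, t = a / (M n)%:R * k%:R].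
Proof.
apply/seteqP; split => t /=.
  move=> [U cU Ut]; have Uoo : (mu U < +oo)%E by rewrite Ut ltry.
  have [n /(_ n (leqnn n))[P UE]] := clopen_finite cU Uoo.
  exists n, (count P (iota 0 (n * M n))).
  by move: Ut; rewrite UE mu_codeset => -[].
(* Level [n] has only [n * M n] odometer cylinders, possibly fewer than [k]. At level [m] there is
   room for the [k * l] smaller ones, where [l] is [M m / M n]. *)
move=> [n [k ->]]; pose m := (n + k)%N.
have [l lE] := odo_dvd q (leq_addr k n).
have l0 : (0 < l)%N by have := odo_gt0 q m; rewrite lE muln_gt0 => /andP[].
have klm : (k * l <= m * M m)%N.
  by rewrite lE leq_mul ?leq_addl// leq_pmull// odo_gt0.
exists (codeset m (mem (iota 0 (k * l)))); first exact: clopen_codeset.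
rewrite mu_codeset count_mem_subseq ?iota_uniq//; last first.
  by rewrite -(subnKC klm) iotaD prefix_subseq.
rewrite size_iota lE !natrM; congr (_%:E).
by field; rewrite !pnatr_eq0 -!lt0n odo_gt0.
Qed.

End odometer_measure_good.

Lemma ipath_splice (B : bratteli) (x y : ipath B) n : bd_src (x n) = bd_src (y n) ->
  exists z : ipath B,
    (forall k, (k < n)%N -> z k = x k) /\ (forall k, (n <= k)%N -> z k = y k).
Proof.
move=> xy; pose e k := if (k < n)%N then x k else y k.
have ee k : bd_tgt (e k) = bd_src (e k.+1).
  rewrite /e; case: (ltngtP k.+1 n) => [kn|nk|kn].
  - exact: ip_compat.
  - exact: ip_compat.
  - by rewrite ip_compat kn.
exists (IPath ee); split => k kn; first by rewrite /= /e kn.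
by rewrite /= /e ltnNge kn.
Qed.

(** * Ergodicity *)

Section odometer_measure_ergodic.
Context {R : realType} {q : nat -> nat} {a : R}.
Local Notation M := (odo q).
Local Notation X := (ipath (odo_diagram q)).
Local Notation path := (@path_of q R).
Local Notation codeset := (@codeset q).
Variable mu : {measure set (borel X) -> \bar R}.
Hypothesis a_gt0 : 0 < a.
Hypothesis muE : forall A,
  mu A = (a%:E * lebesgue_measure [set t : R | A (path t) /\ (0 <= t)%R])%E.
Implicit Types (A U V : set X) (x y : X) (P : pred nat).

Let M0 n : 0 < (M n)%:R :> R. Proof. by rewrite ltr0n odo_gt0. Qed.

(** A generating class of sets of finite measure for the uniqueness theorem. Clopen sets containing
    [path_inf] have infinite measure, so that point enters as a singleton. *)
Definition finite_clopen_or_inf : set (set X) :=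
  [set B | clopen B /\ ~ B (path_inf q) \/ B = [set path_inf q]].

Lemma finite_clopen_or_infI : setI_closed finite_clopen_or_inf.
Proof.
move=> B C; case=> [[[oB cB] nB]|->]; case=> [[[oC cC] nC]|->].
- left; split; last by case.
  by split; [exact: openI|exact: closedI].
- left; rewrite (_ : _ `&` _ = set0); first by split; [exact: clopen0|].
  by rewrite -subset0 => x [/[swap] ->].
- left; rewrite (_ : _ `&` _ = set0); first by split; [exact: clopen0|].
  by rewrite -subset0 => x [->].
- by right; rewrite setIid.
Qed.

(** An open set is a countable union of odometer cylinders, together with [path_inf] if it contains
    that point. *)
Lemma borel_finite_clopen_or_inf :
  @measurable _ (borel X) = <<s finite_clopen_or_inf >>.
Proof.
rewrite eqEsubset; split; last first.
  apply: smallest_sub; first exact: sigma_algebra_measurable.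
  move=> B [[cB _]|->]; first exact: measurable_clopen.
  exact: measurable_path_inf.
apply: smallest_sub; first exact: smallest_sigma_algebra.
have gen0 : <<s finite_clopen_or_inf >> set0.
  by apply: sub_sigma_algebra; left; split; [exact: clopen0|].
move=> U oU.
pose F n j := [set x : X | code n x = Some j /\ [set y : X | code n y = Some j] `<=` U].
pose G n := if n is m.+1 then \bigcup_j F m j else U `&` [set path_inf q].
have -> : U = \bigcup_n G n.
  apply/seteqP; split => x; last first.
    by move=> [[_ []|n _ [j _] [xj]]] //; apply.
  move=> Ux; have [xinf|/path_inf_neq[n [j nj]]] := pselect (x = path_inf q).
    by exists 0%N.
  have [m mU] := (open_code U).1 oU x Ux; exists (n + m).+1 => //.
  case E : (code (n + m) x) => [i|]; last first.
    by have := code_None_le (leq_addr m n) E; rewrite nj.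
  exists i => //; split => // y /= yi; apply: mU.
  by apply: (code_eq_le (leq_addl n m)); rewrite E.
apply: sigma_algebra_bigcup => -[|n] /=.
  have [Uinf|nUinf] := pselect (U (path_inf q)).
    rewrite setIidr; last by move=> _ ->.
    by apply: sub_sigma_algebra; right.
  by rewrite (_ : _ `&` _ = set0)// -subset0 => x [/[swap] ->].
apply: sigma_algebra_bigcup => j.
have [jU|njU] := pselect ([set y : X | code n y = Some j] `<=` U).
  apply: sub_sigma_algebra; left; split; last by move=> []; rewrite code_path_inf.
  rewrite (_ : F n j = [set x : X | [set Some j] (code n x)]); first exact: clopen_codeP.
  by apply/seteqP; split => x; [case|split].
by rewrite (_ : F n j = set0)// -subset0 => x [].
Qed.

(** Changing the prefix of number [i] into that of number [j] maps one intersection onto the other,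
    because [A] is tail-invariant. *)
Lemma odo_measure_code_invariant A (n i j : nat) :
  measurable (A : set (borel X)) -> tail_invariant_set A ->
  (i < n * M n)%N -> (j < n * M n)%N ->
  mu ([set x | code n x = Some i] `&` A) = mu ([set x | code n x = Some j] `&` A).
Proof.
move=> mA tA iM jM.
have codeR k : (k < n * M n)%N -> exists x : X, code n x = Some k.
  move=> kM; exists (path (k%:R / (M n)%:R)).
  have /seteqP[_] := @code_path_of_preimage q R n k kM; apply.
  by rewrite /= in_itv/= lexx ltr_pM2r ?invr_gt0// ltr_nat ltnSn.
have [[x xi] [y yj]] := (codeR i iM, codeR j jM).
have [u _] : exists u : uvert n, True by case: n iM {codeR x xi y yj jM} => //; exists tt.
have [[p pi] [r rj]] := (code_finpath u xi, code_finpath u yj).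
have pE := cylinderE p; have rE := cylinderE r.
rewrite -(odo_measure_tail_invariant muE (p := p) r); first last.
- by rewrite pE pi => z [].
- by apply: measurableI => //; exact: measurable_code.
congr (mu _); apply/seteqP; split => z.
  move=> [+ [w [wi Aw] zw]]; rewrite rE rj => zj; split => //.
  by apply: tA Aw; exists n => k nk; rewrite zw.
move=> [/= zj Az]; split; first by rewrite rE /= rj.
have [w [wx wz]] : exists w : X,
    (forall k, (k < n)%N -> w k = x k) /\ (forall k, (n <= k)%N -> w k = z k).
  by apply: ipath_splice; rewrite (code_src u xi) (code_src u zj).
exists w; last by move=> k nk; rewrite wz.
split; first by rewrite /= (eq_code wx).
by apply: tA Az; exists n => k nk; rewrite wz.
Qed.

Lemma odo_measure_ergodic : ergodic mu.
Proof.
move=> A mA tA.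
pose nu : {measure set (borel X) -> \bar R} := mrestr mu mA.
have nuE B : nu B = mu (B `&` A) by [].
have nu_le B : measurable (B : set (borel X)) -> (nu B <= mu B)%E.
  move=> mB; rewrite nuE; apply: le_odo_measure; [exact: measurableI|exact: mB|].
  by move=> x [].
have nufin n P : nu (codeset n P) \is a fin_num.
  rewrite ge0_fin_numE//; apply: le_lt_trans (nu_le _ (measurable_codeset _ _)) _.
  by rewrite (odo_measure_codeset muE) ltry.
pose b := fine (nu (codeset 1 predT)).
have b0 : 0 <= b by exact: fine_ge0.
(* [nu] gives all the [M n] paths to level [n] that pass through [Some tt] at
   level [1] the same mass, and their total mass is [b]. *)
have nu_code n j : (j < n * M n)%N ->
    nu [set x | code n x = Some j] = (b / (M n)%:R)%:E.
  move=> jn; pose r := fine (nu [set x | code n x = Some j]).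
  have rE i : (i < n * M n)%N -> nu [set x | code n x = Some i] = r%:E.
    move=> iM; rewrite nuE (odo_measure_code_invariant mA tA iM jn) -nuE fineK//.
    rewrite (_ : mkset _ = codeset n (pred1 j))//.
    apply/seteqP; split => x; rewrite /codeset/=; first by move=> -> /=.
    by case: (code n x) => [i'|]//= /eqP ->.
  rewrite rE//; congr (_%:E); apply: (canRL (mulfK _)); first exact: lt0r_neq0.
  have n0 : (0 < n)%N by case: n jn {r rE}.
  have cM : count (fun i => (i < M n)%N) (iota 0 (n * M n)) = M n.
    rewrite -(subnKC (leq_pmull (M n) n0)) iotaD count_cat.
    rewrite (@eq_in_count _ _ predT) ?count_predT ?size_iota; last first.
      by move=> i; rewrite mem_iota.
    rewrite (@eq_in_count _ _ pred0) ?count_pred0 ?addn0// => i.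
    by rewrite mem_iota add0n /= => /andP[Mi _]; rewrite ltnNge Mi.
  (* The numbers below [M n] correspond to the reals in [[0, 1[], and so does [codeset 1 predT];
     comparing preimages gives [r * M n = b]. *)
  have := @measure_codeset R q nu r n (fun i => (i < M n)%N) rE.
  rewrite cM => /(congr1 fine) /= <-; rewrite /b; congr fine.
  rewrite !nuE !muE; congr (_ * lebesgue_measure _)%E.
  have codeset_path m P t : 0 <= t -> codeset m P (path t) =
      ((t < m%:R) && P (Num.truncn (t * (M m)%:R))) :> Prop.
    by move=> t0; rewrite /codeset /mkset code_path_of t0 /=; case: ifP.
  have tM (t : R) : 0 <= t -> (Num.truncn (t * (M n)%:R) < M n)%N = (t < 1).
    by move=> t0; rewrite truncn_lt_nat ?mulr_ge0// -[ltRHS]mul1r ltr_pM2r.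
  apply/seteqP; split => t [[tn At] t0]; split => //; split => //; move: tn;
      rewrite !codeset_path// tM//; first by case/andP=> _ t1; apply/andP.
  by move=> /andP[t1 _]; apply/andP; rewrite (lt_le_trans t1) ?ler1n.
have ba0 : 0 <= b / a by rewrite divr_ge0// ltW.
pose nu' : {measure set (borel X) -> \bar R} := mscale (NngNum ba0) mu.
have nu'E B : nu' B = ((b / a)%:E * mu B)%E by [].
have nuM B : measurable (B : set (borel X)) -> nu B = nu' B.
  (* A countable cover by sets of finite measure, with index 0 reserved for [path_inf]. *)
  pose g n := if n is m.+1 then codeset m predT else [set path_inf q].
  move: B; refine (@measure_unique _ _ (borel X)
    finite_clopen_or_inf g _ _ _ _ nu nu' _ _).
  - exact: borel_finite_clopen_or_inf.
  - exact: finite_clopen_or_infI.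
  - case => [|n]; first by right.
    by left; split; [exact: clopen_codeset|exact: codeset_path_inf].
  - apply/seteqP; split => // x _.
    have [->|/path_inf_neq[n [j nj]]] := pselect (x = path_inf q); first by exists 0%N.
    by exists n.+1 => //; rewrite /g /codeset/= nj.
  - move=> C [[cC nCinf]|->]; last first.
      rewrite nu'E (odo_measure_path_inf muE) mule0; apply/eqP.
      rewrite eq_le measure_ge0 andbT -(odo_measure_path_inf muE).
      by apply: nu_le; exact: measurable_path_inf.
    have [n /(_ n (leqnn n))[[P PE] /(_ nCinf)/setIidPl CE _]] := clopen_codesetE cC.
    rewrite -CE PE nu'E (odo_measure_codeset muE) -EFinM.
    rewrite (@measure_codeset R q nu _ n P (nu_code n)); congr (_%:E).
    by field; rewrite !gt_eqF.
  - case => [|n]; last by have := nufin n predT; rewrite ge0_fin_numE.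
    apply: le_lt_trans (nu_le _ measurable_path_inf) _.
    by rewrite (odo_measure_path_inf muE).
(* Proportionality gives [(b / a) * mu (~ A) = 0]: either the complement is null, or [b / a = 0] and
   then [mu A = nu A = 0]. *)
have /eqP : nu (~` A) = 0%E by rewrite nuE setICl measure0.
rewrite nuM ?nu'E; last exact: measurableC.
rewrite mule_eq0 => /orP[/eqP ba|/eqP]; last by right.
left; have -> : mu A = nu A by rewrite nuE setIid.
by rewrite nuM// nu'E ba mul0e.
Qed.

End odometer_measure_ergodic.

(** * Restriction to the support *)

Lemma sigma_open_preimage {T T' : topologicalType} (f : T -> T') (A : set T') :
  continuous f -> <<s open >> A -> <<s open >> (f @^-1` A).
Proof.
move=> /continuousP cf; apply: (@smallest_sub _ _ _ [set B | <<s open >> (f @^-1` B)]).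
  split.
  - by rewrite /= preimage_set0; exact: sigma_algebra0.
  - move=> B sB; exact: (sigma_algebraCD sB).
  - move=> F sF; rewrite /= preimage_bigcup; exact: sigma_algebra_bigcup.
by move=> B oB; apply: sub_sigma_algebra; exact: cf.
Qed.

Section homeomorphism.
Context {R : realType} {T T' : topologicalType} {f : T -> T'} {g : T' -> T}.
Hypotheses (fK : cancel f g) (gK : cancel g f).
Hypotheses (f_continuous : continuous f) (g_continuous : continuous g).
Variable m : set T' -> \bar R.

Let pullback (A : set T) := m (g @^-1` A).

Let gfK A : g @^-1` (f @^-1` A) = A.
Proof. by apply/funext => x; rewrite /preimage /= gK. Qed.

Let open_g A : open A -> open (g @^-1` A).
Proof. by move: A; exact/continuousP. Qed.

Let clopen_f A : clopen A -> clopen (f @^-1` A).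
Proof. by move=> cA; exact: preimage_clopen. Qed.

Let clopen_g A : clopen A -> clopen (g @^-1` A).
Proof. by move=> cA; exact: preimage_clopen. Qed.

Lemma homeomorphic_cantor_like : cantor_like T' -> cantor_like T.
Proof.
case=> /perfectTP pT' cT' _ zT'.
have zT : zero_dimensional T.
  move=> x y xy; have [|U [cU Ux Uy]] := zT' (f x) (f y).
    by apply: contra_neq xy => /(can_inj fK).
  by exists (f @^-1` U); split => //; exact: clopen_f.
split => //; last exact: zero_dimensional_hausdorff.
- apply/perfectTP => x /open_g; rewrite (_ : _ @^-1` _ = [set f x]); first exact: pT'.
  by apply/seteqP; split => y /= => [<-|->]; rewrite ?fK ?gK.
- have -> : [set: T] = g @` [set: T'].
    by apply/seteqP; split => // x _; exists (f x).
  by apply: continuous_compact => //; exact: continuous_subspaceT.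
Qed.

Lemma homeomorphic_nonatomic : nonatomic m -> nonatomic pullback.
Proof.
move=> nm A sA; rewrite /pullback => mA.
have [C [sC CA C0 CmA]] := nm _ (sigma_open_preimage g_continuous sA) mA.
exists (f @^-1` C); split; rewrite ?gfK//; first exact: sigma_open_preimage.
by move=> x /CA; rewrite /= fK.
Qed.

Lemma homeomorphic_defective_set :
  defective_set pullback = f @^-1` (defective_set m).
Proof.
apply/seteqP; split => x /= mx U cU Ux.
  by rewrite -(gfK U); apply: mx => //; exact: clopen_f.
by apply: mx; [exact: clopen_g|rewrite /= fK].
Qed.

Lemma homeomorphic_good : good_infinite_measure m -> good_infinite_measure pullback.
Proof.
case=> -[cT' fm nm mT dm] gm; split; first split.
- exact: homeomorphic_cantor_like.
- move=> U /open_g oU [x Ux]; apply: fm => //; exists (f x).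
  by rewrite /= fK.
- exact: homeomorphic_nonatomic.
- by rewrite /pullback preimage_setT.
- by rewrite homeomorphic_defective_set /pullback gfK.
move=> U V cU cV /(gm _ _ (clopen_g cU) (clopen_g cV))[W [cW WV WU]].
exists (f @^-1` W); split; rewrite /pullback ?gfK//; first exact: clopen_f.
by move=> x /WV; rewrite /= fK.
Qed.

Lemma homeomorphic_clopen_values : clopen_values pullback = clopen_values m.
Proof.
apply/seteqP; split => r [U cU Ur]; first by exists (g @^-1` U) => //; exact: clopen_g.
by exists (f @^-1` U); [exact: clopen_f|rewrite /pullback gfK].
Qed.

End homeomorphism.

(** As [mu] is full, its support is the whole space, but as a subtype it is only homeomorphic to it;
    the properties are transported along the inclusion and its inverse. *)
Lemma on_support_good {R : realType} {B : bratteli}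
    (mu : {measure set (borel (ipath B)) -> \bar R}) :
  good_infinite_measure (mu : set (ipath B) -> \bar R) ->
  good_infinite_measure (on_support mu) /\
  clopen_values (on_support mu) = clopen_values (mu : set (ipath B) -> \bar R).
Proof.
move=> mu_good; have [[_ mu_full _ _ _] _] := mu_good.
have supT x : x \in msupport mu.
  by apply/mem_set => U oU Ux; apply: mu_full => //; exists x.
pose g x : msupport mu := exist _ x (supT x).
pose f (x : msupport mu) : ipath B := set_val x.
have gK : cancel g f by [].
have fK : cancel f g by move=> x; exact: val_inj.
have cf : continuous f by exact: initial_continuous.
have cg : continuous g.
  by apply/continuousP => _ [U oU <-].
have -> : on_support mu = (fun A => mu (g @^-1` A)).
  apply/funext => A; congr (mu _); apply/seteqP; split => x /=.
    by move=> [y Ay <-]; rewrite -[set_val y]/(f y) fK.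
  by move=> Agx; exists (g x).
split; first exact: (homeomorphic_good fK gK cf cg).
exact: (homeomorphic_clopen_values gK cf cg).
Qed.

Unset Implicit Arguments.

Theorem theorem3p7 (R : realType) (D : set R)
    (D_rational : D `<=` range (@ratr R)) (D_group_like : group_like D) :
  exists (B : bratteli) (mu : {measure set (borel (ipath B)) -> \bar R}),
    [/\ finite_rank B,
        tail_invariant_measure mu,
        ergodic mu,
        good_infinite_measure (on_support mu)
      & clopen_values (on_support mu) = D].
Proof.
have [a [q [a_gt0 DE M_unbounded]]] := group_like_odometer D_group_like D_rational.
have [mu muE] := exists_odo_measure q (ltW a_gt0).
have [mu_good mu_values] := on_support_good (odo_measure_good a_gt0 muE M_unbounded).
exists (odo_diagram q), mu; split => //.
- exact: odo_diagram_finite_rank.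
- exact: odo_measure_tail_invariant muE.
- exact: odo_measure_ergodic a_gt0 muE.
- by rewrite mu_values (odo_measure_clopen_values a_gt0 muE) DE.
Qed.
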